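(* The functors $\mathrm{Mix}_{0,1}$ and $\mathrm{Mix}_{1,1}$ are indecomposable objects of $\mathcal{F}_{quad}$.
   Context: A quadratic space is a finite-dimensional $\mathbb{F}_2$-vector space with a quadratic form $q$, with associated bilinear form $B(x,y)=q(x+y)+q(x)+q(y)$; it is nondegenerate if $B$ is. $\mathcal{E}$ is the category of all $\mathbb{F}_2$-vector spaces. $\bot$ denotes orthogonal sum. $\mathcal{E}_q$: nondegenerate quadratic spaces with linear maps preserving the quadratic forms (these are injective). $\mathcal{T}_q$: same objects as $\mathcal{E}_q$; $\mathrm{Hom}_{\mathcal{T}_q}(V,W)$ is the set of equivalence classes $[V\xrightarrow{f}X\xleftarrow{g}W]$ of diagrams in $\mathcal{E}_q$, for the equivalence relation generated by: $(f,g)$ is related to $(\alpha f,\alpha g)$ for every morphism $\alpha:X\to X'$ of $\mathcal{E}_q$. Every morphism has a representative $[V\xrightarrow{f}W\bot W'\xleftarrow{i_W}W]$ with $i_W$ the canonical inclusion; composition is $[W\xrightarrow{\varphi}Z\bot L\leftarrow Z]\circ[V\xrightarrow{f}W\bot W'\leftarrow W]=[V\xrightarrow{(\varphi\bot\mathrm{Id})f}Z\bot L\bot W'\leftarrow Z]$. Write $p_W$ for the orthogonal projection onto $W$. $\mathcal{F}_{quad}$ is the category of functors $\mathcal{T}_q\to\mathcal{E}$. For $\alpha\in\{0,1\}$ the mixed functor $\mathrm{Mix}_{\alpha,1}:\mathcal{T}_q\to\mathcal{E}$ is $\mathrm{Mix}_{\alpha,1}(V)=\mathbb{F}_2[S_V]$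 (free vector space), $S_V=\{(v_1,v_2)\in V\times V: q(v_1+v_2)=\alpha,\ B(v_1,v_2)=1\}$, with $[V\xrightarrow{f}W\bot L\xleftarrow{i_W}W]$ sending $[(v_1,v_2)]$ to $[(p_Wf(v_1),p_Wf(v_2))]$ if $f(v_1+v_2)\in W$ and to $0$ otherwise. *)

(* Defs.v *)
From HB Require Import structures.
From mathcomp Require Import all_boot all_algebra.
From mathcomp Require Import freeg ring.
From Stdlib Require Import Relations FunctionalExtensionality.
From Stdlib Require Import PropExtensionality ProofIrrelevance IndefiniteDescription.

Set Implicit Arguments.
Unset Strict Implicit.
Unset Printing Implicit Defensive.

Import GRing.Theory.
Local Open Scope ring_scope.
Local Obligation Tactic := idtac.

Record category := Category {
  ob :> Type;
  hom : ob -> ob -> Type;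
  idm : forall A, hom A A;
  comp : forall A B C, hom B C -> hom A B -> hom A C;
  comp_idl : forall A B (f : hom A B), comp (idm B) f = f;
  comp_idr : forall A B (f : hom A B), comp f (idm A) = f;
  comp_assoc : forall A B C D (h : hom C D) (g : hom B C) (f : hom A B),
    comp h (comp g f) = comp (comp h g) f
}.
Arguments idm {c} A.
Arguments comp {c A B C}.

Definition isomorphic (C : category) (A B : C) : Prop :=
  exists (f : hom A B) (g : hom B A), comp g f = idm A /\ comp f g = idm B.

Record functor (C D : category) := Functor {
  fob :> C -> D;
  fmor : forall A B : C, hom A B -> hom (fob A) (fob B);
  fmor_id : forall A : C, fmor (idm A) = idm (fob A);
  fmor_comp : forall (X Y Z : C) (g : hom Y Z) (f : hom X Y),
    fmor (comp g f) = comp (fmor g) (fmor f)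
}.
Arguments fmor {C D} _ {A B}.

Record nattrans (C D : category) (F G : functor C D) := NatTrans {
  ntc :> forall A : C, hom (F A) (G A);
  nt_natural : forall (A B : C) (u : hom A B),
    comp (ntc B) (fmor F u) = comp (fmor G u) (ntc A)
}.

Arguments NatTrans {C D F G}.

Section FunctorCategory.
Variables C D : category.

Lemma nattrans_eq (F G : functor C D) (s t : nattrans F G) :
  (forall A, s A = t A) -> s = t.
Proof.
case: s t => [s sP] [t tP] /= st.
have e : s = t by apply: functional_extensionality_dep.
by subst; rewrite (proof_irrelevance _ sP tP).
Qed.

Program Definition nt_id (F : functor C D) : nattrans F F :=
  NatTrans (fun A => idm (F A)) _.
Next Obligation. by move=> F A B u; rewrite comp_idl comp_idr. Qed.

Program Definition nt_comp (F G H : functor C D)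
    (t : nattrans G H) (s : nattrans F G) : nattrans F H :=
  NatTrans (fun A => comp (t A) (s A)) _.
Next Obligation.
move=> F G H t s A B u.
by rewrite -comp_assoc nt_natural comp_assoc nt_natural comp_assoc.
Qed.

Program Definition functor_category : category :=
  @Category (functor C D) (@nattrans C D) nt_id nt_comp _ _ _.
Next Obligation. by move=> F G s; apply: nattrans_eq => A /=; rewrite comp_idl. Qed.
Next Obligation. by move=> F G s; apply: nattrans_eq => A /=; rewrite comp_idr. Qed.
Next Obligation. by move=> *; apply: nattrans_eq => A /=; rewrite comp_assoc. Qed.

End FunctorCategory.

Lemma linear_eq (A B : lmodType 'F_2) (f g : {linear A -> B}) :
  f =1 g -> f = g.
Proof.
case: f g => [f [[fD] [fZ]]] [g [[gD] [gZ]]] /= /functional_extensionality fg.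
by subst; rewrite (proof_irrelevance _ fD gD) (proof_irrelevance _ fZ gZ).
Qed.

Definition lin_id (A : lmodType 'F_2) : {linear A -> A} := idfun.
Definition lin_comp (A B C : lmodType 'F_2)
    (g : {linear B -> C}) (f : {linear A -> B}) : {linear A -> C} := g \o f.

Program Definition Vect2 : category :=
  @Category (lmodType 'F_2) (fun A B => {linear A -> B}) lin_id lin_comp _ _ _.
Next Obligation. by move=> *; apply: linear_eq. Qed.
Next Obligation. by move=> *; apply: linear_eq. Qed.
Next Obligation. by move=> *; apply: linear_eq. Qed.

Definition polar (V : vectType 'F_2) (q : V -> 'F_2) (x y : V) : 'F_2 :=
  q (x + y) + q x + q y.

(* Linearity of [polar q] in its first argument suffices: it is symmetric. *)
Definition is_quadratic_form (V : vectType 'F_2) (q : V -> 'F_2) : Prop :=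
  (forall (a : 'F_2) (x : V), q (a *: x) = a ^+ 2 * q x) /\
  (forall (a : 'F_2) (x y z : V),
     polar q (a *: x + y) z = a * polar q x z + polar q y z).

Definition nondegenerate (V : vectType 'F_2) (q : V -> 'F_2) : Prop :=
  forall x : V, (forall y : V, polar q x y = 0) -> x = 0.

Record quad_space := QuadSpace {
  qs_space :> vectType 'F_2;
  qf : qs_space -> 'F_2;
  qf_quadratic : is_quadratic_form qf;
  qf_nondegenerate : nondegenerate qf
}.

Notation bf V := (polar (@qf V)).

Record isometry (V W : quad_space) := Isometry {
  iso_lin :> {linear V -> W};
  iso_qf : forall v, qf (iso_lin v) = qf v
}.

Section QuadTheory.
Variable V : quad_space.
Implicit Types x y z : V.

Lemma bfC x y : bf V x y = bf V y x.
Proof. by rewrite /polar (addrC x) -!addrA (addrC (qf x)). Qed.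

Lemma bfP a x y z : bf V (a *: x + y) z = a * bf V x z + bf V y z.
Proof. by case: (qf_quadratic V). Qed.

Lemma bfDl x y z : bf V (x + y) z = bf V x z + bf V y z.
Proof. by have := bfP 1 x y z; rewrite scale1r mul1r. Qed.

Lemma bf0l z : bf V 0 z = 0.
Proof. by apply: (addrI (bf V 0 z)); rewrite -bfDl !addr0. Qed.

Lemma bfZl a x z : bf V (a *: x) z = a * bf V x z.
Proof. by have := bfP a x 0 z; rewrite !addr0 bf0l addr0. Qed.

Lemma bfNl x z : bf V (- x) z = - bf V x z.
Proof. by rewrite -scaleN1r bfZl mulN1r. Qed.

Lemma qf0 : qf (0 : V) = 0.
Proof. by case: (qf_quadratic V) => /(_ 0 0); rewrite scaler0 expr0n mul0r. Qed.

Lemma F2_addrr (a : 'F_2) : a + a = 0.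
Proof. exact: (addrr_pchar2 (pchar_Fp (isT : prime 2))). Qed.

Lemma F2_oppr (a : 'F_2) : - a = a.
Proof. by apply/eqP; rewrite eq_sym -addr_eq0 F2_addrr. Qed.

Lemma qfD x y : qf (x + y) = qf x + qf y + bf V x y.
Proof.
have -> : qf x + qf y + bf V x y = (qf x + qf x) + (qf y + qf y) + qf (x + y).
  by rewrite /polar; ring.
by rewrite !F2_addrr !add0r.
Qed.

End QuadTheory.

Lemma iso_bf V W (f : isometry V W) x y : bf W (f x) (f y) = bf V x y.
Proof. by rewrite /polar -linearD !iso_qf. Qed.

Definition iso_id (V : quad_space) : isometry V V :=
  @Isometry V V (lin_id V) (fun v => erefl).

Program Definition iso_comp (V W X : quad_space)
    (g : isometry W X) (f : isometry V W) : isometry V X :=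
  @Isometry V X (lin_comp g f) _.
Next Obligation. by move=> V W X g f v /=; rewrite !iso_qf. Qed.

Section OrthogonalSum.
Variables V W : quad_space.

Definition qf_sum (p : (V * W)%type) : 'F_2 := qf p.1 + qf p.2.

Lemma polar_sum x y : polar qf_sum x y = bf V x.1 y.1 + bf W x.2 y.2.
Proof. by rewrite /polar /qf_sum /=; ring. Qed.

Lemma qf_sum_quadratic : is_quadratic_form qf_sum.
Proof.
split=> [a x|a x y z].
  by rewrite /qf_sum /= !(proj1 (qf_quadratic _)); ring.
by rewrite !polar_sum /= !bfP; ring.
Qed.

Lemma qf_sum_nondegenerate : nondegenerate qf_sum.
Proof.
move=> [x1 x2] H; congr (_, _); apply: qf_nondegenerate => y.
  by have := H (y, 0); rewrite polar_sum /= (bfC x2) bf0l addr0.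
by have := H (0, y); rewrite polar_sum /= (bfC x1) bf0l add0r.
Qed.

Definition quad_sum : quad_space :=
  QuadSpace qf_sum_quadratic qf_sum_nondegenerate.

End OrthogonalSum.

Declare Scope quad_scope.
Delimit Scope quad_scope with quad.
Bind Scope quad_scope with quad_space.
Local Open Scope quad_scope.
Infix "⊥" := quad_sum (at level 50, left associativity) : quad_scope.

Section SumMorphisms.

Definition inl_fun (V W : quad_space) (v : V) : V ⊥ W := (v, 0).
Lemma inl_fun_linear (V W : quad_space) : linear (@inl_fun V W).
Proof. by move=> a x y; rewrite /inl_fun; congr (_, _); rewrite /= scaler0 addr0. Qed.
HB.instance Definition _ (V W : quad_space) :=
  GRing.isLinear.Build 'F_2 V (V ⊥ W) _ (@inl_fun V W) (@inl_fun_linear V W).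
Lemma inl_fun_qf (V W : quad_space) (v : V) : qf (@inl_fun V W v) = qf v.
Proof. by rewrite /= /qf_sum /= qf0 addr0. Qed.
Definition iso_inl (V W : quad_space) : isometry V (V ⊥ W) :=
  @Isometry V (V ⊥ W) (@inl_fun V W) (@inl_fun_qf V W).

Definition sum_fun (V V' W W' : quad_space) (f : isometry V V')
  (g : isometry W W') (p : V ⊥ W) : V' ⊥ W' := (f p.1, g p.2).
Lemma sum_fun_linear V V' W W' f g : linear (@sum_fun V V' W W' f g).
Proof. by move=> a x y; rewrite /sum_fun; congr (_, _); rewrite /= linearP. Qed.
HB.instance Definition _ (V V' W W' : quad_space) (f : isometry V V')
    (g : isometry W W') :=
  GRing.isLinear.Build 'F_2 (V ⊥ W) (V' ⊥ W') _ (@sum_fun V V' W W' f g)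
    (@sum_fun_linear V V' W W' f g).
Lemma sum_fun_qf V V' W W' f g p : qf (@sum_fun V V' W W' f g p) = qf p.
Proof. by rewrite /= /qf_sum /= !iso_qf. Qed.
Definition iso_sum (V V' W W' : quad_space) (f : isometry V V')
    (g : isometry W W') : isometry (V ⊥ W) (V' ⊥ W') :=
  @Isometry (V ⊥ W) (V' ⊥ W') (sum_fun f g) (sum_fun_qf f g).

Definition assoc_fun (V W X : quad_space) (p : V ⊥ W ⊥ X) : V ⊥ (W ⊥ X) :=
  (p.1.1, (p.1.2, p.2)).
Lemma assoc_fun_linear V W X : linear (@assoc_fun V W X).
Proof. by []. Qed.
HB.instance Definition _ (V W X : quad_space) :=
  GRing.isLinear.Build 'F_2 (V ⊥ W ⊥ X) (V ⊥ (W ⊥ X)) _ (@assoc_fun V W X)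
    (@assoc_fun_linear V W X).
Lemma assoc_fun_qf V W X p : qf (@assoc_fun V W X p) = qf p.
Proof. by rewrite /= /qf_sum /= /qf_sum /= addrA. Qed.
Definition iso_assoc (V W X : quad_space) : isometry (V ⊥ W ⊥ X) (V ⊥ (W ⊥ X)) :=
  @Isometry (V ⊥ W ⊥ X) (V ⊥ (W ⊥ X)) (@assoc_fun V W X) (@assoc_fun_qf V W X).

End SumMorphisms.

Record cospan (V W : quad_space) := Cospan {
  apex : quad_space;
  lleg : isometry V apex;
  rleg : isometry W apex
}.

Definition cospan_step V W (c d : cospan V W) : Prop :=
  exists alpha : isometry (apex c) (apex d),
    (forall v, lleg d v = alpha (lleg c v)) /\
    (forall w, rleg d w = alpha (rleg c w)).

Definition cospan_equiv V W : cospan V W -> cospan V W -> Prop :=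
  clos_refl_sym_trans _ (@cospan_step V W).

(* A morphism is an equivalence class of diagrams, kept as a predicate: the
   diagrams form a type too large to carry a choiceType structure, hence no
   quotient in the sense of generic_quotient. *)
Record tq_hom (V W : quad_space) := TqHom {
  tq_class :> cospan V W -> Prop;
  tq_classP : exists c, forall d, tq_class d <-> cospan_equiv c d
}.

Definition tq_of V W (c : cospan V W) : tq_hom V W :=
  @TqHom V W (cospan_equiv c) (ex_intro _ c (fun d => iff_refl _)).

Definition can_cospan V W L (f : isometry V (W ⊥ L)) : cospan V W :=
  Cospan f (iso_inl W L).

(* (phi ⊥ Id) f, reassociated so that Z is again the first summand. *)
Definition can_comp V W Z W' L (phi : isometry W (Z ⊥ L))
    (f : isometry V (W ⊥ W')) : isometry V (Z ⊥ (L ⊥ W')) :=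
  iso_comp (iso_assoc Z L W') (iso_comp (iso_sum phi (iso_id W')) f).

Definition tq_comp_class V W Z (D : tq_hom W Z) (C : tq_hom V W)
    (d : cospan V Z) : Prop :=
  exists (W' L : quad_space) (f : isometry V (W ⊥ W')) (phi : isometry W (Z ⊥ L)),
    [/\ C (can_cospan f), D (can_cospan phi)
      & cospan_equiv (can_cospan (can_comp phi f)) d].

Lemma cospan_refl V W (c : cospan V W) : cospan_equiv c c.
Proof. exact: rst_refl. Qed.

Lemma cospan_sym V W (c d : cospan V W) : cospan_equiv c d -> cospan_equiv d c.
Proof. exact: rst_sym. Qed.

Lemma cospan_trans V W (c d e : cospan V W) :
  cospan_equiv c d -> cospan_equiv d e -> cospan_equiv c e.
Proof. exact: rst_trans. Qed.

Lemma tq_hom_eq V W (C D : tq_hom V W) : (forall c, C c <-> D c) -> C = D.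
Proof.
case: C D => [C CP] [D DP] /= CD.
have e : C = D by apply: functional_extensionality => c; apply: propositional_extensionality.
by subst; rewrite (proof_irrelevance _ CP DP).
Qed.

Lemma tq_hom_equiv V W (C : tq_hom V W) c d : C c -> C d -> cospan_equiv c d.
Proof.
by case: (tq_classP C) => e H /H ec /H; apply: cospan_trans; apply: cospan_sym.
Qed.

Lemma tq_hom_closed V W (C : tq_hom V W) c d : C c -> cospan_equiv c d -> C d.
Proof.
by case: (tq_classP C) => e H /H ec cd; apply/H; apply: cospan_trans ec cd.
Qed.

Lemma tq_ofE V W (C : tq_hom V W) c : C c -> C = tq_of c.
Proof.
by move=> Cc; apply: tq_hom_eq => d; split; [apply: tq_hom_equiv | apply: tq_hom_closed].
Qed.

Lemma tq_of_equiv V W (c d : cospan V W) : tq_of c = tq_of d <-> cospan_equiv c d.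
Proof.
split=> [e|e].
  by have : tq_of d d := cospan_refl d; rewrite -e.
exact: tq_ofE.
Qed.

Lemma bilinear_representable (F : fieldType) (V : vectType F) (b : V -> V -> F) :
  (forall w, linear (b w : V -> F^o)) -> (forall w', linear (b^~ w' : V -> F^o)) ->
  (forall x, (forall y, b x y = 0) -> x = 0) ->
  forall l : {linear V -> F^o}, exists w, forall w', l w' = b w w'.
Proof.
move=> blr bll nd l.
pose bw w : {linear V -> F^o} := HB.pack (b w : V -> F^o)
  (GRing.isLinear.Build F V F^o _ (b w : V -> F^o) (blr w)).
have pl : linear (fun w => linfun (bw w)).
  move=> a x y; apply/lfunP => z.
  by rewrite add_lfunE scale_lfunE !lfunE; apply: (bll z).
pose ph : {linear V -> 'Hom(V, F^o)} := HB.pack (fun w => linfun (bw w))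
  (GRing.isLinear.Build F V 'Hom(V, F^o) _ (fun w => linfun (bw w)) pl).
have phE w w' : ph w w' = b w w' by exact: (lfunE (bw w) w').
have ker0 : lker (linfun ph) == 0%VS.
  apply/lker0P => x y; rewrite !(lfunE ph) => e; apply/eqP.
  rewrite -subr_eq0; apply/eqP/nd => z.
  have bz := bll z (-1) y x; rewrite [x - y]addrC -scaleN1r bz.
  by rewrite -!phE e scaleN1r addNr.
have im : limg (linfun ph) = fullv.
  apply/eqP; rewrite eqEdim subvf /= limg_dim_eq ?(eqP ker0) ?capv0 //.
  by rewrite !dimvf /dim /= muln1.
have : linfun l \in limg (linfun ph) by rewrite im memvf.
case/memv_imgP => w _ e; exists w => w'.
by rewrite -phE -[l w'](lfunE l) e lfunE.
Qed.

Section Adjoint.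
Variables (W X : quad_space) (g : isometry W X).

Lemma adj_ex (x : X) : exists w : W, forall w', bf X x (g w') = bf W w w'.
Proof.
have bl : linear (fun w' => bf X x (g w') : ('F_2)^o).
  by move=> a u v; rewrite !(bfC x) linearP bfP.
pose l : {linear W -> ('F_2)^o} := HB.pack (fun w' => bf X x (g w') : ('F_2)^o)
  (GRing.isLinear.Build 'F_2 W ('F_2)^o _ (fun w' => bf X x (g w') : ('F_2)^o) bl).
have blr w : linear (bf W w : W -> ('F_2)^o) by move=> a u v; rewrite !(bfC w) bfP.
have bll w : linear (fun u => bf W u w : ('F_2)^o) by move=> a u v; rewrite bfP.
have [w Hw] := bilinear_representable blr bll (@qf_nondegenerate W) l.
by exists w => w'; rewrite -Hw.
Qed.

(* Orthogonal projection of X onto the image of g, read in W. *)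
Definition adj (x : X) : W := proj1_sig (constructive_indefinite_description _ (adj_ex x)).

Lemma adjP x w : bf W (adj x) w = bf X x (g w).
Proof. by rewrite /adj; case: constructive_indefinite_description => u /= ->. Qed.

Lemma adj_unique x u : (forall w, bf W u w = bf X x (g w)) -> adj x = u.
Proof.
move=> H; apply/eqP; rewrite -subr_eq0; apply/eqP/qf_nondegenerate => w.
by rewrite bfDl bfNl adjP H subrr.
Qed.

Lemma adj_linear : linear adj.
Proof. by move=> a x y; apply: adj_unique => w; rewrite !bfP !adjP. Qed.

HB.instance Definition _ := GRing.isLinear.Build 'F_2 X W _ adj adj_linear.

Lemma adjK w : adj (g w) = w.
Proof. by apply: adj_unique => w'; rewrite iso_bf. Qed.

Definition compl_vs : {vspace X} := lker (linfun adj).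

Lemma mem_compl x : (x \in compl_vs) = (adj x == 0).
Proof. by rewrite memv_ker lfunE. Qed.

Definition compl_qf (u : subvs_of compl_vs) : 'F_2 := qf (vsval u).

Lemma compl_polar u v : polar compl_qf u v = bf X (vsval u) (vsval v).
Proof. by rewrite /polar /compl_qf linearD. Qed.

Lemma compl_quadratic : is_quadratic_form compl_qf.
Proof.
split=> [a x|a x y z]; first by rewrite /compl_qf linearZ (proj1 (qf_quadratic _)).
by rewrite !compl_polar linearP bfP.
Qed.

Lemma adj_decomp x : x = g (adj x) + (x - g (adj x)).
Proof. by rewrite addrC subrK. Qed.

Lemma adj_res x : x - g (adj x) \in compl_vs.
Proof. by rewrite mem_compl linearB /= adjK subrr. Qed.

Lemma compl_orth (x : X) w : x \in compl_vs -> bf X x (g w) = 0.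
Proof. by rewrite mem_compl -adjP => /eqP ->; rewrite bf0l. Qed.

Lemma compl_nondegenerate : nondegenerate compl_qf.
Proof.
move=> u H; apply: val_inj; apply: (@qf_nondegenerate X) => y.
rewrite (adj_decomp y) bfC bfDl -!(bfC (vsval u)).
rewrite compl_orth ?subvsP // add0r.
by have := H (vsproj compl_vs (y - g (adj y))); rewrite compl_polar vsprojK ?adj_res.
Qed.

Definition compl : quad_space := QuadSpace compl_quadratic compl_nondegenerate.

Definition to_compl (x : X) : compl := vsproj compl_vs (x - g (adj x)).

Lemma to_complK x : vsval (to_compl x) = x - g (adj x).
Proof. by rewrite vsprojK ?adj_res. Qed.

Lemma to_compl_linear : linear to_compl.
Proof.
move=> a x y; apply: val_inj; rewrite /= !to_complK.
rewrite (linearP adj) (linearP g) opprD scalerBr !addrA; congr (_ - _).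
by rewrite addrAC.
Qed.

Lemma qf_decomp x : qf x = qf (adj x) + qf (to_compl x).
Proof.
rewrite {1}[x]adj_decomp qfD iso_qf bfC compl_orth ?adj_res // addr0.
by rewrite /= /compl_qf to_complK.
Qed.

Definition split_fun (x : X) : W ⊥ compl := (adj x, to_compl x).
Lemma split_fun_linear : linear split_fun.
Proof. by move=> a x y; rewrite /split_fun to_compl_linear linearP. Qed.
HB.instance Definition _ :=
  GRing.isLinear.Build 'F_2 X (W ⊥ compl) _ split_fun split_fun_linear.
Lemma split_fun_qf x : qf (split_fun x) = qf x.
Proof. by rewrite [RHS]qf_decomp. Qed.
Definition iso_split : isometry X (W ⊥ compl) :=
  @Isometry X (W ⊥ compl) split_fun split_fun_qf.

Lemma iso_split_g w : iso_split (g w) = (w, 0).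
Proof.
congr (_, _); first exact: adjK.
by apply: val_inj; rewrite /= to_complK adjK subrr.
Qed.

End Adjoint.

Lemma iso_eq0 V W (f : isometry V W) v : (f v == 0) = (v == 0).
Proof.
apply/eqP/eqP => [fv0|->]; last exact: linear0.
by apply: qf_nondegenerate => y; rewrite -(iso_bf f) fv0 bf0l.
Qed.

(* Composition of arbitrary diagrams; it is only used to show that the
   composition of T_q, defined on the representatives V -> W ⊥ W' <- W,
   does not depend on the choices. *)
Section GeneralComposition.

Definition can_lleg V W (c : cospan V W) : isometry V (W ⊥ compl (rleg c)) :=
  iso_comp (iso_split (rleg c)) (lleg c).

Definition gcomp V W Z (d : cospan W Z) (c : cospan V W) : cospan V Z :=
  Cospan (iso_comp (iso_sum (lleg d) (iso_id (compl (rleg c)))) (can_lleg c))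
         (iso_comp (iso_inl (apex d) (compl (rleg c))) (rleg d)).

Lemma can_lleg_equiv V W (c : cospan V W) : cospan_equiv c (can_cospan (can_lleg c)).
Proof.
apply: rst_step; exists (iso_split (rleg c)); split=> [//|w].
by rewrite [RHS]iso_split_g.
Qed.

Section ComplMap.
Variables (W X X' : quad_space) (g : isometry W X) (g' : isometry W X').
Variable alpha : isometry X X'.
Hypothesis gE : forall w, g' w = alpha (g w).

Lemma adj_map x : adj g' (alpha x) = adj g x.
Proof. by apply: adj_unique => w; rewrite adjP gE iso_bf. Qed.

Definition compl_map_fun (u : compl g) : compl g' := vsproj _ (alpha (vsval u)).

Lemma compl_map_val u : vsval (compl_map_fun u) = alpha (vsval u).
Proof. by rewrite vsprojK // mem_compl adj_map -mem_compl subvsP. Qed.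

Lemma compl_map_linear : linear compl_map_fun.
Proof.
by move=> a x y; apply: val_inj; rewrite /= !(compl_map_val, linearP).
Qed.
HB.instance Definition _ :=
  GRing.isLinear.Build 'F_2 (compl g) (compl g') _ compl_map_fun compl_map_linear.

Lemma compl_map_qf u : qf (compl_map_fun u) = qf u.
Proof. by rewrite /= /compl_qf compl_map_val iso_qf. Qed.

Definition compl_map : isometry (compl g) (compl g') :=
  @Isometry (compl g) (compl g') compl_map_fun compl_map_qf.

Lemma to_compl_map x : to_compl g' (alpha x) = compl_map (to_compl g x).
Proof.
apply: val_inj; rewrite /= !to_complK compl_map_val to_complK.
by rewrite adj_map gE linearB.
Qed.

End ComplMap.

Section ComplInl.
Variables W L : quad_space.

Lemma adj_inl (x : W ⊥ L) : adj (iso_inl W L) x = x.1.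
Proof.
apply: adj_unique => w; rewrite [RHS](polar_sum x (w, 0)) /=.
by rewrite (bfC x.2) bf0l addr0.
Qed.

Definition compl_inl_fun (u : compl (iso_inl W L)) : L := (vsval u : W ⊥ L).2.
Lemma compl_inl_linear : linear compl_inl_fun.
Proof. by move=> a x y; rewrite /compl_inl_fun linearP. Qed.
HB.instance Definition _ :=
  GRing.isLinear.Build 'F_2 (compl (iso_inl W L)) L _ compl_inl_fun compl_inl_linear.
Lemma compl_inl_qf u : qf (compl_inl_fun u) = qf u.
Proof.
have := subvsP u; rewrite mem_compl adj_inl => /eqP u1.
by rewrite /= /compl_qf /= /qf_sum u1 qf0 add0r.
Qed.
Definition compl_inl : isometry (compl (iso_inl W L)) L :=
  @Isometry (compl (iso_inl W L)) L compl_inl_fun compl_inl_qf.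

Lemma to_compl_inl x : compl_inl (to_compl (iso_inl W L) x) = x.2.
Proof.
rewrite /= /compl_inl_fun to_complK adj_inl /=.
by rewrite subr0.
Qed.

End ComplInl.

Lemma gcomp_stepr V W Z (d : cospan W Z) (c c' : cospan V W) :
  cospan_step c c' -> cospan_equiv (gcomp d c) (gcomp d c').
Proof.
case=> al [lE rE]; apply: rst_step.
exists (iso_sum (iso_id (apex d)) (compl_map rE)); split=> [v|z].
  by rewrite /= /sum_fun /= lE (adj_map rE) (to_compl_map rE).
by congr (_, _); apply/esym/(linear0 (compl_map rE)).
Qed.

Lemma gcomp_stepl V W Z (d d' : cospan W Z) (c : cospan V W) :
  cospan_step d d' -> cospan_equiv (gcomp d c) (gcomp d' c).
Proof.
case=> al [lE rE]; apply: rst_step.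
exists (iso_sum al (iso_id (compl (rleg c)))); split=> [v|z].
  by rewrite /= /sum_fun /= lE.
by rewrite /= /sum_fun /inl_fun /= rE.
Qed.

Lemma gcomp_equiv V W Z (d d' : cospan W Z) (c c' : cospan V W) :
  cospan_equiv d d' -> cospan_equiv c c' -> cospan_equiv (gcomp d c) (gcomp d' c').
Proof.
move=> dd' cc'; apply: (@cospan_trans _ _ _ (gcomp d' c)).
  elim: dd' => [x y s|x|x y _|x y z _ xy _]; first exact: gcomp_stepl.
  - exact: cospan_refl.
  - exact: cospan_sym.
  - exact: cospan_trans.
elim: cc' => [x y s|x|x y _|x y z _ xy _]; first exact: gcomp_stepr.
- exact: cospan_refl.
- exact: cospan_sym.
- exact: cospan_trans.
Qed.

Lemma gcomp_can V W Z W' L (phi : isometry W (Z ⊥ L)) (f : isometry V (W ⊥ W')) :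
  cospan_equiv (gcomp (can_cospan phi) (can_cospan f)) (can_cospan (can_comp phi f)).
Proof.
apply: rst_step.
exists (iso_comp (iso_assoc Z L W') (iso_sum (iso_id (Z ⊥ L)) (compl_inl W W'))).
split=> [v|z] /=; last by congr (_, (_, _)); apply/esym/(linear0 (compl_inl W W')).
by rewrite /sum_fun /= adj_inl [compl_inl_fun _]to_compl_inl.
Qed.

Lemma tq_comp_classE V W Z (d : cospan W Z) (c : cospan V W) e :
  tq_comp_class (tq_of d) (tq_of c) e <-> cospan_equiv (gcomp d c) e.
Proof.
split=> [[W' [L [f [phi [cf dphi]]]]]|ge].
  apply: cospan_trans; apply: cospan_trans (gcomp_can phi f).
  exact: gcomp_equiv.
exists (compl (rleg c)), (compl (rleg d)), (can_lleg c), (can_lleg d).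
split; try exact: can_lleg_equiv.
apply: cospan_trans ge; apply: cospan_trans (cospan_sym (gcomp_can _ _)) _.
by apply: gcomp_equiv; apply/cospan_sym/can_lleg_equiv.
Qed.

End GeneralComposition.

Lemma tq_homE V W (C : tq_hom V W) : exists c, C = tq_of c.
Proof.
case: (tq_classP C) => c Cc; exists c; apply: tq_ofE.
by apply/Cc/cospan_refl.
Qed.

Lemma tq_comp_classP V W Z (D : tq_hom W Z) (C : tq_hom V W) :
  exists c, forall d, tq_comp_class D C d <-> cospan_equiv c d.
Proof.
have [d ->] := tq_homE D; have [c ->] := tq_homE C.
by exists (gcomp d c) => e; apply: tq_comp_classE.
Qed.

Definition tq_comp V W Z (D : tq_hom W Z) (C : tq_hom V W) : tq_hom V Z :=
  TqHom (tq_comp_classP D C).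

Definition tq_id (V : quad_space) : tq_hom V V := tq_of (Cospan (iso_id V) (iso_id V)).

Lemma tq_comp_of V W Z (d : cospan W Z) (c : cospan V W) :
  tq_comp (tq_of d) (tq_of c) = tq_of (gcomp d c).
Proof. by apply: tq_hom_eq => e; apply: tq_comp_classE. Qed.

Lemma tq_can_ex V W (C : tq_hom V W) :
  exists (L : quad_space) (f : isometry V (W ⊥ L)), C (can_cospan f).
Proof.
have [c ->] := tq_homE C; exists (compl (rleg c)), (can_lleg c).
exact: can_lleg_equiv.
Qed.

Lemma tq_comp_can V W Z W' L (phi : isometry W (Z ⊥ L)) (f : isometry V (W ⊥ W')) :
  tq_comp (tq_of (can_cospan phi)) (tq_of (can_cospan f)) =
  tq_of (can_cospan (can_comp phi f)).
Proof. by rewrite tq_comp_of; apply/tq_of_equiv/gcomp_can. Qed.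

Lemma tq_comp_idl V W (C : tq_hom V W) : tq_comp (tq_id W) C = C.
Proof.
have [c ->] := tq_homE C; rewrite tq_comp_of; apply/tq_of_equiv/cospan_sym.
apply: rst_step; exists (iso_split (rleg c)); split=> [v|w] //.
by rewrite iso_split_g.
Qed.

Lemma tq_comp_idr V W (C : tq_hom V W) : tq_comp C (tq_id V) = C.
Proof.
have [c ->] := tq_homE C; rewrite tq_comp_of; apply/tq_of_equiv/cospan_sym.
apply: rst_step; exists (iso_inl (apex c) (compl (iso_id V))); split=> [v|w] //.
by rewrite /= [split_fun _ _](iso_split_g (iso_id V)).
Qed.

Lemma tq_comp_assoc V W Z T (E : tq_hom Z T) (D : tq_hom W Z) (C : tq_hom V W) :
  tq_comp E (tq_comp D C) = tq_comp (tq_comp E D) C.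
Proof.
have [W' [f /tq_ofE ->]] := tq_can_ex C; have [L [phi /tq_ofE ->]] := tq_can_ex D.
have [M [chi /tq_ofE ->]] := tq_can_ex E.
rewrite !tq_comp_can; apply/tq_of_equiv/cospan_sym/rst_step.
exists (iso_sum (iso_id T) (iso_assoc M L W')).
by split.
Qed.

Definition Tq : category :=
  @Category quad_space tq_hom tq_id tq_comp tq_comp_idl tq_comp_idr tq_comp_assoc.

Definition Fquad : category := functor_category Tq Vect2.

Section DirectSum.
Variable C : category.
Variables F G : functor C Vect2.

Section PairMap.
Variables (A A' B B' : lmodType 'F_2) (f : {linear A -> A'}) (g : {linear B -> B'}).
Definition pair_map (p : (A * B)%type) : (A' * B')%type := (f p.1, g p.2).
Lemma pair_map_linear : linear pair_map.
Proof. by move=> a x y; rewrite /pair_map !linearP. Qed.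
HB.instance Definition _ :=
  GRing.isLinear.Build 'F_2 (A * B)%type (A' * B')%type _ pair_map pair_map_linear.
End PairMap.

Program Definition direct_sum : functor C Vect2 :=
  @Functor C Vect2 (fun V => (F V * G V)%type : lmodType 'F_2)
    (fun V W (u : hom V W) => pair_map (fmor F u) (fmor G u)) _ _.
Next Obligation.
by move=> V; apply: linear_eq => -[x y]; rewrite /= /pair_map !fmor_id.
Qed.
Next Obligation.
by move=> U V W g f; apply: linear_eq => -[x y]; rewrite /= /pair_map !fmor_comp.
Qed.

End DirectSum.

Definition is_zero (F : Fquad) : Prop := forall (V : Tq) (x : fob F V), x = 0.

Definition indecomposable (F : Fquad) : Prop :=
  ~ is_zero F /\
  forall A B : Fquad,
    isomorphic F (direct_sum A B : Fquad) -> is_zero A \/ is_zero B.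

Section FreeVect.
Variable K : choiceType.

Definition fgen (k : K) : {freeg K / 'F_2} := [freeg [:: (1, k)]].

Variables (M : lmodType 'F_2) (h : K -> M).

Definition fext (x : {freeg K / 'F_2}) : M := fglift h x.

Lemma fext_linear : linear fext.
Proof.
have eB x y : fext (x - y) = fext x - fext y by apply: (@lift_is_additive _ K M h).
have e0 : fext 0 = 0 by rewrite -[0 in LHS](subrr 0) eB subrr.
have eN y : fext (- y) = - fext y by rewrite -[- y]add0r eB e0 add0r.
have eD x y : fext (x + y) = fext x + fext y by rewrite -[y in LHS]opprK eB eN opprK.
move=> a x y; rewrite eD; congr (_ + _).
have [->|->] : a = 0 \/ a = 1.
  by case: a => -[|[|//]] ?; [left|right]; apply: val_inj.
  by rewrite !scale0r.
by rewrite !scale1r.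
Qed.
HB.instance Definition _ :=
  GRing.isLinear.Build 'F_2 {freeg K / 'F_2} M _ fext fext_linear.

Lemma fext_gen k : fext (fgen k) = h k.
Proof. by rewrite /fext liftU scale1r. Qed.

End FreeVect.

Lemma fext_unique (K : choiceType) (M : lmodType 'F_2)
    (u v : {linear {freeg K / 'F_2} -> M}) :
  (forall k, u (fgen k) = v (fgen k)) -> u = v.
Proof.
move=> uv; apply: linear_eq; elim/freeg_ind_dom0 => [|a k D _ _ IH].
  by rewrite !linear0.
have -> : << a *g k >> = a *: fgen k :> {freeg K / 'F_2}.
  by apply/eqP/freeg_eqP => z; rewrite coeffZ !coeffU mul1r.
by rewrite !linearD !linearZ /= uv IH.
Qed.

Section Mixed.
Variable alpha : 'F_2.

Definition mix_pred (V : quad_space) (p : (V * V)%type) : bool :=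
  (qf (p.1 + p.2) == alpha) && (bf V p.1 p.2 == 1).

Definition mix_set (V : quad_space) : choiceType := {p : (V * V)%type | mix_pred p}.

Definition mix_ob (V : quad_space) : lmodType 'F_2 := {freeg (mix_set V) / 'F_2}.

Section Basis.
Variables (V W L : quad_space) (f : isometry V (W ⊥ L)).

Lemma mix_pred_proj (v1 v2 : V) : mix_pred (v1, v2) ->
  (f (v1 + v2)).2 = 0 -> mix_pred ((f v1).1, (f v2).1).
Proof.
rewrite /mix_pred /= => /andP[qv /eqP bv] f2.
have e2 : (f v2).2 = (f v1).2.
  move: f2; rewrite linearD /= => /eqP; rewrite addr_eq0 => /eqP e.
  by rewrite e -scaleN1r F2_oppr scale1r.
apply/andP; split.
  rewrite -(eqP qv) -(iso_qf f (v1 + v2)) /= /qf_sum f2 qf0 addr0.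
  by rewrite linearD.
have := iso_bf f v1 v2; rewrite [LHS]polar_sum e2 bv => <-.
have xx0 (x : L) : x + x = 0 by rewrite -[x]scale1r -scalerDl F2_addrr scale0r.
have -> : bf L (f v1).2 (f v1).2 = 0 by rewrite /polar xx0 qf0 add0r F2_addrr.
by rewrite addr0.
Qed.

(* In V -f-> W ⊥ L <- W, the element f (v1 + v2) lies in W when its second
   component vanishes, and p_W f v is (f v).1. *)
Definition mix_basis (s : mix_set V) : mix_ob W :=
  let: exist (v1, v2) vP := s in
  match (f (v1 + v2)).2 =P 0 with
  | ReflectT f2 => fgen (exist (@mix_pred W) _ (mix_pred_proj vP f2))
  | ReflectF _ => 0
  end.

Definition mix_can : {linear mix_ob V -> mix_ob W} := fext mix_basis.

Lemma mix_can_in (s : mix_set V) (t : mix_set W) :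
  (f ((val s).1 + (val s).2)).2 = 0 ->
  val t = ((f (val s).1).1, (f (val s).2).1) ->
  mix_can (fgen s) = fgen t.
Proof.
rewrite /= fext_gen; case: s => [[v1 v2] vP] /= f2 tE.
case: eqP => [f2'|//]; congr fgen.
by apply: val_inj; rewrite [RHS]tE.
Qed.

Lemma mix_can_out (s : mix_set V) :
  (f ((val s).1 + (val s).2)).2 <> 0 -> mix_can (fgen s) = 0.
Proof.
by rewrite /= fext_gen; case: s => [[v1 v2] vP] /= f2; case: eqP.
Qed.

End Basis.

Definition tq_rep V W (C : tq_hom V W) : {L : quad_space & isometry V (W ⊥ L)} :=
  let (L, H) := constructive_indefinite_description _ (tq_can_ex C) in
  existT _ L (proj1_sig (constructive_indefinite_description _ H)).

Lemma tq_repP V W (C : tq_hom V W) : C (can_cospan (projT2 (tq_rep C))).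
Proof.
rewrite /tq_rep; case: constructive_indefinite_description => L H /=.
by case: constructive_indefinite_description.
Qed.

Definition mix_mor V W (C : tq_hom V W) : {linear mix_ob V -> mix_ob W} :=
  mix_can (projT2 (tq_rep C)).

Lemma mix_can_ext V W L L' (f : isometry V (W ⊥ L)) (f' : isometry V (W ⊥ L')) :
  (forall v, (f v).1 = (f' v).1) ->
  (forall v, ((f v).2 == 0) = ((f' v).2 == 0)) ->
  mix_can f = mix_can f'.
Proof.
move=> e1 e2; apply: fext_unique => -[[v1 v2] vP].
have [f2|f2] := (f (v1 + v2)).2 =P 0; last first.
  rewrite !mix_can_out //=.
  by apply/eqP; rewrite -e2; apply/eqP.
have f2' : (f' (v1 + v2)).2 = 0 by apply/eqP; rewrite -e2 f2.
rewrite (mix_can_in (t := exist (@mix_pred W) _ (mix_pred_proj vP f2))) //.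
by apply/esym/mix_can_in => //=; rewrite !e1.
Qed.

Lemma mix_equiv V W (c d : cospan V W) :
  cospan_equiv c d -> mix_can (can_lleg c) = mix_can (can_lleg d).
Proof.
elim=> {c d} [c d [al [lE rE]]|//|c d _ ->|c d e _ -> _ ->] //.
apply: mix_can_ext => v /=; rewrite lE; first by rewrite (adj_map rE).
by rewrite (to_compl_map rE) (iso_eq0 (compl_map rE)).
Qed.

Lemma mix_can_lleg V W L (f : isometry V (W ⊥ L)) :
  mix_can (can_lleg (can_cospan f)) = mix_can f.
Proof.
apply: mix_can_ext => v /=; first by rewrite adj_inl.
by rewrite -(iso_eq0 (compl_inl W L)) to_compl_inl.
Qed.

(* The value of Mix on a morphism of T_q is given by the defining formula, for
   every choice of the representative. *)
Lemma mix_morE V W L (f : isometry V (W ⊥ L)) (C : tq_hom V W) :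
  C (can_cospan f) -> mix_mor C = mix_can f.
Proof.
move=> Cf; rewrite /mix_mor -mix_can_lleg -[RHS]mix_can_lleg.
exact/mix_equiv/(tq_hom_equiv (tq_repP C) Cf).
Qed.

Lemma mix_mor_id V : mix_mor (tq_id V) = lin_id (mix_ob V).
Proof.
have Ci := can_lleg_equiv (Cospan (iso_id V) (iso_id V)).
rewrite (@mix_morE _ _ _ _ (tq_id V) Ci); apply: fext_unique => s.
have E v : can_lleg (Cospan (iso_id V) (iso_id V)) v = (v, 0).
  exact: (iso_split_g (iso_id V)).
apply: mix_can_in; rewrite !E //.
by case: s => -[].
Qed.

Lemma mix_mor_comp V W Z (D : tq_hom W Z) (C : tq_hom V W) :
  mix_mor (tq_comp D C) = lin_comp (mix_mor D) (mix_mor C).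
Proof.
have [W' [f Cf]] := tq_can_ex C; have [L [phi Dphi]] := tq_can_ex D.
rewrite (mix_morE Cf) (mix_morE Dphi) (@mix_morE _ _ _ (can_comp phi f)); last first.
  by rewrite (tq_ofE Cf) (tq_ofE Dphi) tq_comp_can; apply: cospan_refl.
apply: fext_unique => -[[v1 v2] vP]; rewrite /lin_comp [RHS]/=.
have [f2|f2] := (f (v1 + v2)).2 =P 0; last first.
  rewrite [fext (mix_basis f) _]mix_can_out // linear0 mix_can_out //.
  by case.
rewrite [fext (mix_basis f) _](mix_can_in (t := exist (@mix_pred W) _ (mix_pred_proj vP f2))) //.
have [p2|p2] := (phi ((f v1).1 + (f v2).1)).2 =P 0; last first.
  rewrite [RHS]mix_can_out // mix_can_out //= => -[] p2' _; apply: p2.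
  by move: p2'; rewrite (linearD f).
rewrite [RHS](mix_can_in (t := exist (@mix_pred Z) _ (mix_pred_proj (mix_pred_proj vP f2) p2))) //.
apply: mix_can_in => //=; congr (_, _) => //.
by move: p2; rewrite (linearD f).
Qed.

(* Mix1 alpha is the functor Mix_{alpha,1}. *)
Definition Mix1 : Fquad :=
  @Functor Tq Vect2 mix_ob mix_mor mix_mor_id mix_mor_comp.

End Mixed.

(* Main.v *)
(* Write a basis element of Mix_{alpha,1}(V) as s = (v, v + w), with q(w) = alpha
   and B(v, w) = 1.  For every other basis element t = (v', v' + w') of
   Mix_{alpha,1}(W) there is a morphism V -> W of T_q that sends s to t and whose
   action has image in the span of t and of its swap (v' + w', v'): take g
   mapping v to v', w to w' and killing the orthogonal of <v, w>, and complete it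
   by a map V -> L with kernel exactly {0, w}, so that a basis element whose sum
   differs from w is sent to 0.  By naturality an endomorphism is therefore
   a + b tau with a, b in F_2 constant and tau the swap, an involution.  As
   (a + b tau)^2 = a + b, the only idempotents are 0 and 1. *)

From HB Require Import structures.
From mathcomp Require Import all_boot all_algebra.
From mathcomp Require Import freeg ring.
Require Import Defs.

Set Implicit Arguments.
Unset Strict Implicit.
Unset Printing Implicit Defensive.

Import GRing.Theory.
Local Open Scope ring_scope.
Local Open Scope quad_scope.

(** * Arithmetic and bilinear algebra in characteristic 2 *)

Lemma F2_cases (a : 'F_2) : a = 0 \/ a = 1.
Proof. by case: a => -[|[|//]] ?; [left|right]; apply: val_inj. Qed.

Lemma F2_vaddrr (M : lmodType 'F_2) (x : M) : x + x = 0.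
Proof. by rewrite -[x]scale1r -scalerDl F2_addrr scale0r. Qed.

Lemma F2_vaddKr (M : lmodType 'F_2) (x y : M) : x + (x + y) = y.
Proof. by rewrite addrA F2_vaddrr add0r. Qed.

Lemma F2_vaddr_eq0 (M : lmodType 'F_2) (x y : M) : x + y = 0 -> x = y.
Proof. by move=> e; rewrite -[y](F2_vaddKr x) e addr0. Qed.

Lemma bfxx (V : quad_space) (x : V) : bf V x x = 0.
Proof. by rewrite /polar F2_vaddrr qf0 add0r F2_addrr. Qed.

Lemma bfDr (V : quad_space) (x y z : V) : bf V z (x + y) = bf V z x + bf V z y.
Proof. by rewrite bfC bfDl !(bfC _ z). Qed.

Lemma bfZr (V : quad_space) a (x z : V) : bf V z (a *: x) = a * bf V z x.
Proof. by rewrite bfC bfZl (bfC x). Qed.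

Lemma qfZ (V : quad_space) a (x : V) : qf (a *: x) = a * qf x.
Proof.
rewrite (proj1 (qf_quadratic V)).
by case: (F2_cases a) => ->; rewrite ?expr0n ?expr1n.
Qed.

Lemma fgen_ind (K : choiceType) (P : {freeg K / 'F_2} -> Prop) :
  P 0 -> (forall k x, P x -> P (fgen k + x)) -> forall x, P x.
Proof.
move=> P0 PD; elim/freeg_ind_dom0 => [//|a k D _ _ PD'].
have -> : << a *g k >> = a *: fgen k :> {freeg K / 'F_2}.
  by apply/eqP/freeg_eqP => z; rewrite coeffZ !coeffU mul1r.
by have [->|->] := F2_cases a; rewrite ?scale0r ?add0r ?scale1r //; apply: PD.
Qed.

(** * Nondegenerate extension of a quadratic form *)

(* Every quadratic form r on V, degenerate or not, embeds via x |-> (x, 0) in a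
   nondegenerate space; V stands for its own dual in the second factor. *)
Section ExtendForm.
Variables (V : quad_space) (r : V -> 'F_2).
Hypothesis rQ : is_quadratic_form r.

Definition ext_qf (p : (V * V)%type) : 'F_2 := r p.1 + bf V p.1 p.2.

Lemma ext_polar x y :
  polar ext_qf x y = polar r x.1 y.1 + (bf V x.1 y.2 + bf V y.1 x.2).
Proof.
rewrite {1}/polar /ext_qf /= bfDl !bfDr.
(* [ring] is not aware of characteristic 2, so the doubled terms are displayed and cancelled by
   hand. *)
rewrite [LHS](_ : _ = polar r x.1 y.1 + (bf V x.1 y.2 + bf V y.1 x.2) +
  (bf V x.1 x.2 + bf V x.1 x.2) + (bf V y.1 y.2 + bf V y.1 y.2)).
  by rewrite !F2_addrr !addr0.
by rewrite [polar r _ _]/polar; ring.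
Qed.

Lemma ext_quadratic : is_quadratic_form ext_qf.
Proof.
case: rQ => rZ rB; split=> [a x|a x y z].
  by rewrite /ext_qf /= rZ bfZl bfZr; ring.
by rewrite !ext_polar /= rB bfP bfDr bfZr; ring.
Qed.

(** Pairing with (0, y) leaves only B(x1, y), which forces x1 = 0; pairing with (y, 0) then leaves
    only B(y, x2). *)
Lemma ext_nondegenerate : nondegenerate ext_qf.
Proof.
case: rQ => _ rB; move=> [x1 x2] H.
have r0 x : polar r 0 x = 0.
  by have := rB 1 0 0 x; rewrite scale1r mul1r addr0 F2_addrr.
have x10 : x1 = 0.
  apply: qf_nondegenerate => y; have := H (0, y).
  have -> : polar ext_qf (x1, x2) (0, y) = polar ext_qf (0, y) (x1, x2).
    by rewrite /polar [in RHS]addrAC [(0, y) + _]addrC.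
  by rewrite ext_polar /= r0 bf0l !add0r.
rewrite x10; congr (_, _); apply: qf_nondegenerate => y.
have := H (y, 0); rewrite ext_polar /= x10 r0 bf0l !add0r.
by rewrite bfC.
Qed.

Definition ext_space : quad_space := QuadSpace ext_quadratic ext_nondegenerate.

End ExtendForm.

(** * Transfer of one basis element to another *)

Section Transfer.
Variables (V W : quad_space) (v w : V) (v' w' : W).
Hypotheses (qw : qf w' = qf w) (bvw : bf V v w = 1) (bvw' : bf W v' w' = 1).

(** Orthogonal projection onto the plane spanned by v and w, followed by v to v' and w to w'. *)
Definition tr_fst (x : V) : W := bf V x v *: w' + bf V x w *: v'.

Lemma tr_fst_linear : linear tr_fst.
Proof.
move=> a x y; rewrite /tr_fst !bfP 2!(scalerDl _ (a * _)) scalerDr !scalerA.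
by rewrite addrACA.
Qed.
HB.instance Definition _ := GRing.isLinear.Build 'F_2 V W _ tr_fst tr_fst_linear.

(** As q(v) and q(v') may differ, [tr_fst] need not preserve q even on that plane. The defect is the
    value that the second component must contribute; it may be degenerate, hence the use of
    [ext_space]. *)
Definition tr_defect (x : V) : 'F_2 := qf x + qf (tr_fst x).

Lemma tr_defect_polar x y :
  polar tr_defect x y = bf V x y + bf W (tr_fst x) (tr_fst y).
Proof. by rewrite /polar /tr_defect linearD /=; ring. Qed.

Lemma tr_defect_quadratic : is_quadratic_form tr_defect.
Proof.
split=> [a x|a x y z].
  by rewrite /tr_defect linearZ /= !(proj1 (qf_quadratic _)); ring.
by rewrite !tr_defect_polar linearP /= !bfP; ring.
Qed.

Definition tr_space : quad_space := ext_space tr_defect_quadratic.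

Lemma tr_fst_w : tr_fst w = w'.
Proof. by rewrite /tr_fst bfC bvw bfxx scale1r scale0r addr0. Qed.

(* w is in the radical of the defect, so the defect survives the projection
   x |-> x + B(x, v) w, whose kernel is {0, w}. *)
Lemma tr_defect_radical x a : tr_defect (x + a *: w) = tr_defect x.
Proof.
have -> : tr_defect (x + a *: w) =
    polar tr_defect x (a *: w) + tr_defect x + tr_defect (a *: w).
  rewrite /polar -[LHS]addr0 -[0](F2_addrr (tr_defect x)).
  rewrite -[LHS]addr0 -[0](F2_addrr (tr_defect (a *: w))); ring.
have -> : tr_defect (a *: w) = 0.
  by rewrite /tr_defect linearZ /= tr_fst_w !qfZ qw F2_addrr.
rewrite tr_defect_polar linearZ /= tr_fst_w !bfZr -mulrDr.
rewrite /tr_fst bfDl !bfZl bfxx bvw' mulr0 add0r mulr1 F2_addrr.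
by rewrite mulr0 add0r addr0.
Qed.

Definition tr_fun (x : V) : W ⊥ tr_space := (tr_fst x, (x + bf V x v *: w, 0)).

Lemma tr_fun_linear : linear tr_fun.
Proof.
move=> a x y; rewrite /tr_fun; congr (_, _); first exact: linearP.
congr (_, _); last by rewrite /= scaler0 addr0.
by rewrite bfP scalerDl /= scalerDr scalerA addrACA.
Qed.
HB.instance Definition _ :=
  GRing.isLinear.Build 'F_2 V (W ⊥ tr_space) _ tr_fun tr_fun_linear.

Lemma tr_fun_qf x : qf (tr_fun x) = qf x.
Proof.
rewrite /= /qf_sum /= /ext_qf /= (bfC _ 0) bf0l addr0 tr_defect_radical.
by rewrite /tr_defect addrC -addrA F2_addrr addr0.
Qed.

Definition transfer : isometry V (W ⊥ tr_space) :=
  @Isometry V (W ⊥ tr_space) tr_fun tr_fun_qf.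

Lemma exists_transfer : exists (L : quad_space) (f : isometry V (W ⊥ L)),
  (forall x, (f x).1 = bf V x v *: w' + bf V x w *: v') /\
  (forall x, ((f x).2 == 0) = (x == 0) || (x == w)).
Proof.
exists tr_space, transfer; split=> [//|x].
apply/eqP/orP => [[/F2_vaddr_eq0 xE]|[]/eqP->].
- by rewrite xE; case: (F2_cases (bf V x v)) => ->;
    rewrite ?scale0r ?scale1r eqxx; [left|right].
- by rewrite linear0.
by rewrite /= bfC bvw scale1r F2_vaddrr.
Qed.

End Transfer.

(** * The swap involution *)

Section Swap.
Variables (alpha : 'F_2) (V : quad_space).

Lemma mix_pred_swap (p : (V * V)%type) :
  mix_pred alpha p -> mix_pred alpha (p.2, p.1).
Proof. by rewrite /mix_pred /= addrC bfC. Qed.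

Definition mix_swap (s : mix_set alpha V) : mix_set alpha V :=
  exist (@mix_pred alpha V) _ (mix_pred_swap (valP s)).

Lemma mix_swapK : involutive mix_swap.
Proof. by move=> s; apply: val_inj; case: s => -[]. Qed.

(** A fixed point would have equal entries, but B(v, v) = 0. *)
Lemma mix_swap_neq s : mix_swap s != s.
Proof.
apply/eqP => /(congr1 val); case: s => -[v1 v2] /= vP [e _].
by move: vP; rewrite /mix_pred /= e bfxx => /andP[].
Qed.

End Swap.

(** * Endomorphisms of the mixed functor *)

Section Endomorphisms.
Variable alpha : 'F_2.

Lemma mix_transfer (V W : quad_space) (s : mix_set alpha V) (t : mix_set alpha W) :
  exists C : tq_hom V W,
    [/\ mix_mor alpha C (fgen s) = fgen t,
        mix_mor alpha C (fgen (mix_swap s)) = fgen (mix_swap t)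
      & forall x, exists a b,
          mix_mor alpha C x = a *: fgen t + b *: fgen (mix_swap t)].
Proof.
case: s t => -[v1 v2] vP [[v1' v2'] vP'].
set s := exist (@mix_pred alpha V) _ vP; set t := exist (@mix_pred alpha W) _ vP'.
have [qv bv] : qf (v1 + v2) = alpha /\ bf V v1 v2 = 1.
  by case/andP: (vP) => /eqP ? /eqP.
have [qv' bv'] : qf (v1' + v2') = alpha /\ bf W v1' v2' = 1.
  by case/andP: (vP') => /eqP ? /eqP.
(* The sums get opaque names, so that they are expanded only on demand. *)
have [w wE] : {w | w = v1 + v2} by exists (v1 + v2).
have [w' wE'] : {w' | w' = v1' + v2'} by exists (v1' + v2').
have qw : qf w' = qf w by rewrite wE wE' qv qv'.
have bw : bf V v1 w = 1 by rewrite wE bfDr bfxx add0r.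
have bw' : bf W v1' w' = 1 by rewrite wE' bfDr bfxx add0r.
have [L [f [f1 fker]]] := exists_transfer qw bw bw'.
have fv1 : (f v1).1 = v1' by rewrite f1 bw bfxx scale1r scale0r add0r.
have fw : (f w).1 = w' by rewrite f1 bfC bw bfxx scale1r scale0r addr0.
have fv2 : (f v2).1 = v2'.
  have -> : v2 = v1 + w by rewrite wE F2_vaddKr.
  by rewrite linearD [LHS]/= fv1 fw wE' F2_vaddKr.
have gen (u : mix_set alpha V) : exists a b : 'F_2,
    mix_can alpha f (fgen u) = a *: fgen t + b *: fgen (mix_swap t).
  case: u => -[u1 u2] uP; have bu : bf V u1 u2 = 1 by case/andP: (uP) => _ /eqP.
  (* A sum other than w could be killed only if it were 0, which would give B(u1, u2) = 0; so such a
     generator is sent to 0. *)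
  have [uw|uw] := eqVneq (u1 + u2) w; last first.
    exists 0, 0; rewrite !scale0r addr0; apply: mix_can_out => /= /eqP.
    rewrite fker (negPf uw) orbF => /eqP /F2_vaddr_eq0 u12.
    by move: bu; rewrite u12 bfxx => /eqP; rewrite eq_sym oner_eq0.
  have k0 : (f (u1 + u2)).2 = 0 by apply/eqP; rewrite fker uw eqxx orbT.
  have fu1 : (f u1).1 = bf V u1 v1 *: w' + v1'.
    by rewrite f1 -uw bfDr bfxx bu add0r scale1r.
  have fu2 : (f u2).1 = (f u1).1 + w'.
    by rewrite -fw -uw [f (_ + _)]linearD /= F2_vaddKr.
  (* For sum w, the first entry u1 goes to v1' or to v1' + w' = v2' according to B(u1, v1): the
     image is [t] or its swap. *)
  have [b0|b1] := F2_cases (bf V u1 v1).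
    exists 1, 0; rewrite scale1r scale0r addr0; apply: mix_can_in => //=.
    by rewrite fu2 fu1 b0 scale0r add0r wE' F2_vaddKr.
  exists 0, 1; rewrite scale1r scale0r add0r; apply: mix_can_in => //=.
  by rewrite fu2 fu1 b1 scale1r (addrC w') wE' F2_vaddKr [v1' + _]addrC F2_vaddKr.
exists (tq_of (can_cospan f)).
rewrite (@mix_morE _ _ _ _ f); last exact: cospan_refl.
split.
- apply: mix_can_in => /=; last by rewrite fv1 fv2.
  by apply/eqP; rewrite fker -wE eqxx orbT.
- apply: mix_can_in => /=; last by rewrite fv1 fv2.
  by apply/eqP; rewrite fker addrC -wE eqxx orbT.
elim/fgen_ind => [|k x [a1 [b1 IH]]].
  by exists 0, 0; rewrite linear0 !scale0r addr0.
have [a2 [b2 E]] := gen k; exists (a2 + a1), (b2 + b1).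
by rewrite linearD IH E !scalerDl addrACA.
Qed.

Variable e : forall V : quad_space, {linear mix_ob alpha V -> mix_ob alpha V}.
Hypothesis e_nat : forall (V W : quad_space) (C : tq_hom V W) x,
  e W (mix_mor alpha C x) = mix_mor alpha C (e V x).

(** A transfer of [s] to itself fixes [fgen s], so naturality puts the image of [fgen s] under [e]
    in the span of [s] and its swap. A transfer from [s] to [t] carries the two coefficients over
    unchanged. *)
Lemma mix_endo_coef (V : quad_space) (s : mix_set alpha V) : exists a b,
  forall (W : quad_space) (t : mix_set alpha W),
    e W (fgen t) = a *: fgen t + b *: fgen (mix_swap t).
Proof.
have [C [Cs _ Cspan]] := mix_transfer s s.
have [a [b es]] := Cspan (e V (fgen s)); exists a, b => W t.
have [D [Ds Dws _]] := mix_transfer s t.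
by rewrite -Ds e_nat -[in LHS]Cs e_nat es linearD !linearZ /= Ds Dws.
Qed.

Hypothesis e_idem : forall V x, e V (e V x) = e V x.

Lemma mix_idempotent (V : quad_space) (s : mix_set alpha V) :
  (forall (W : quad_space) x, e W x = 0) \/ (forall (W : quad_space) x, e W x = x).
Proof.
have [a [b eE]] := mix_endo_coef s.
have b0 : b = 0.
  (* At the swap of [s], the square of [e] has coefficient ab + ba = 0, while [e] has coefficient
     b. *)
  have := e_idem (fgen s); rewrite !eE linearD !linearZ /= !eE mix_swapK.
  rewrite !scalerDr !scalerA (mulrC b a) => /(congr1 (coeff (mix_swap s))).
  rewrite !coeffD !coeffZ !coeffU eqxx eq_sym (negPf (mix_swap_neq s)).
  rewrite !mulr0 !mulr1 !add0r !addr0.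
  by rewrite F2_addrr.
have ext (W : quad_space) (u : {linear mix_ob alpha W -> mix_ob alpha W}) :
  (forall t, e W (fgen t) = u (fgen t)) -> forall x, e W x = u x.
  by move=> /fext_unique ->.
have [a0|a1] := F2_cases a; [left|right] => W x.
  by apply: (ext W (\0)) => t; rewrite eE a0 b0 !scale0r addr0.
by apply: (ext W (lin_id _)) => t; rewrite eE a1 b0 scale1r scale0r addr0.
Qed.

End Endomorphisms.

(** * The hyperbolic plane *)

Section HyperbolicPlane.

Let plane : vectType 'F_2 := (('F_2)^o * ('F_2)^o)%type.

Definition hyp_qf (p : plane) : 'F_2 := (p.1 : 'F_2) * (p.2 : 'F_2).

Lemma hyp_polar (x y : plane) :
  polar hyp_qf x y = (x.1 : 'F_2) * (y.2 : 'F_2) + (y.1 : 'F_2) * (x.2 : 'F_2).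
Proof.
have -> : polar hyp_qf x y =
    (hyp_qf x + hyp_qf x) + (hyp_qf y + hyp_qf y) +
    ((x.1 : 'F_2) * (y.2 : 'F_2) + (y.1 : 'F_2) * (x.2 : 'F_2)).
  by rewrite /polar /hyp_qf /=; ring.
by rewrite !F2_addrr !add0r.
Qed.

Lemma hyp_quadratic : is_quadratic_form hyp_qf.
Proof.
split=> [a x|a x y z]; first by rewrite /hyp_qf /= /GRing.scale /=; ring.
by rewrite !hyp_polar /= /GRing.scale /=; ring.
Qed.

Lemma hyp_nondegenerate : nondegenerate hyp_qf.
Proof.
move=> [x1 x2] H; congr (_, _).
  by have := H (0, 1); rewrite hyp_polar /= mulr1 mul0r addr0.
by have := H (1, 0); rewrite hyp_polar /= mulr0 mul1r add0r.
Qed.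

Definition hyp_plane : quad_space := QuadSpace hyp_quadratic hyp_nondegenerate.

(** The two vectors add up to (1, alpha), where q is alpha. This basis element makes the functor
    nonzero and serves as the base point [s]. *)
Lemma mix_pred_hyp (alpha : 'F_2) :
  @mix_pred alpha hyp_plane ((0, 1), (1, alpha + 1)).
Proof.
apply/andP; split.
  by rewrite /= /hyp_qf /= add0r mul1r addrCA F2_addrr addr0.
by rewrite hyp_polar /= mul0r mulr1 add0r.
Qed.

Definition mix_hyp alpha : mix_set alpha hyp_plane :=
  exist (@mix_pred alpha hyp_plane) _ (mix_pred_hyp alpha).

End HyperbolicPlane.

(** * Idempotents and direct sum decompositions *)

Definition nt_at (C : category) (F G : functor C Vect2) (e : nattrans F G) (V : C) :
  {linear fob F V -> fob G V} := ntc e V.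

Section Projection.
Variables (C : category) (A B : functor C Vect2).

Definition proj_fst_at (V : C) :
    {linear (fob A V * fob B V)%type -> (fob A V * fob B V)%type} :=
  pair_map (lin_id (fob A V)) (\0 : {linear fob B V -> fob B V}).

Lemma proj_fst_natural (V W : C) (u : hom V W) :
  @comp Vect2 _ _ _ (proj_fst_at W) (fmor (direct_sum A B) u) =
  @comp Vect2 _ _ _ (fmor (direct_sum A B) u) (proj_fst_at V).
Proof.
by apply: linear_eq => -[x y]; rewrite /= /pair_map /= linear0.
Qed.

Definition proj_fst : nattrans (direct_sum A B) (direct_sum A B) :=
  @NatTrans C Vect2 (direct_sum A B) (direct_sum A B) proj_fst_at proj_fst_natural.

End Projection.

(** The projection onto A, transported along the isomorphism, is an idempotent e of F. If e = 0 the
    projection vanishes and A is zero; if e is the identity, so is the projection, and B is zero. *)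
Lemma idempotent_indecomposable (F : Fquad) : ~ is_zero F ->
  (forall e : hom F F, comp e e = e ->
     (forall (V : Tq) (x : fob F V), nt_at e V x = 0) \/ e = idm F) ->
  indecomposable F.
Proof.
move=> F0 He; split=> // A B [phi [psi [psiK phiK]]].
pose p : hom (direct_sum A B : Fquad) (direct_sum A B) := proj_fst A B.
have pp : comp p p = p.
  by apply: nattrans_eq => V; apply: linear_eq => -[x y].
pose e : hom F F := comp psi (comp p phi).
have ee : comp e e = e.
  rewrite /e -[LHS]comp_assoc; congr (comp psi _).
  by rewrite -comp_assoc [comp phi _]comp_assoc phiK comp_idl comp_assoc pp.
have pe : comp phi (comp e psi) = p.
  by rewrite /e -!comp_assoc phiK comp_idr comp_assoc phiK comp_idl.
have pE V x : nt_at p V x = nt_at phi V (nt_at e V (nt_at psi V x)).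
  by rewrite -[in LHS]pe.
case: (He e ee) => [e0|e1]; [left=> V a|right=> V b].
  by have := pE V (a, 0); rewrite e0 linear0 => -[].
have p1 : p = idm _ by rewrite -pe e1 comp_idl.
have : nt_at p V (0, b) = (0, b) by rewrite p1.
by case.
Qed.

(** * Indecomposability of the mixed functors *)

Lemma mix_indecomposable (alpha : 'F_2) : indecomposable (Mix1 alpha).
Proof.
apply: idempotent_indecomposable => [M0|e ee].
  have /(congr1 (coeff (mix_hyp alpha))) := M0 hyp_plane (fgen (mix_hyp alpha)).
  by rewrite coeffU eqxx coeff0 => /eqP; rewrite mul1r oner_eq0.
have e_nat (V W : quad_space) (C : tq_hom V W) x :
    nt_at e W (mix_mor alpha C x) = mix_mor alpha C (nt_at e V x).
  have := nt_natural e (C : @hom Tq V W).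
  by move=> /(congr1 (fun h : {linear mix_ob alpha V -> mix_ob alpha W} => h x)).
have e_idem (V : quad_space) x : nt_at e V (nt_at e V x) = nt_at e V x.
  by rewrite -[in RHS]ee.
have [e0|e1] := mix_idempotent e_nat e_idem (mix_hyp alpha); first by left.
by right; apply: nattrans_eq => V; apply: linear_eq => x; apply: e1.
Qed.

Theorem proposition3p24 : indecomposable (Mix1 0) /\ indecomposable (Mix1 1).
Proof. by split; apply: mix_indecomposable. Qed.
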